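(* If $\kappa\ge\|f'\|_{C[-\beta,\beta]}$, then the GSAV-EI2 scheme preserves the maximum bound principle unconditionally: for every time step size $\tau>0$, if $\|u_{\rm init}\|_\infty\le\beta$, then $\|u^n\|_\infty\le\beta$ for all $n\ge0$.
   Context: Spatial setting. Let $L>0$, $\Omega=(0,L)\times(0,L)$, $|\Omega|=L^2$, $M$ a positive integer, $h=L/M$. Let $\mathcal{M}_h$ be the finite-dimensional space of real grid functions $v=(v_{ij})_{i,j\in\mathbb{Z}}$ that are $M$-periodic in each index. For $v,w\in\mathcal{M}_h$ set $\langle v,w\rangle=h^2\sum_{i,j=1}^M v_{ij}w_{ij}$, $\|v\|=\sqrt{\langle v,v\rangle}$, $\|v\|_\infty=\max_{1\le i,j\le M}|v_{ij}|$. The discrete Laplacian is $\Delta_h v_{ij}=h^{-2}(v_{i+1,j}+v_{i-1,j}+v_{i,j+1}+v_{i,j-1}-4v_{ij})$. Scalar functions act on grid functions pointwise; functions of self-adjoint linear operators on $\mathcal{M}_h$ are understood as matrix functions; $I$ is the identity. Standing assumptions. $\varepsilon>0$; $f:\mathbb{R}\to\mathbb{R}$ is continuously differentiable and there is a constant $\beta>0$ (fixed) with $f(\beta)\le 0\le f(-\beta)$; $\|f'\|_{C[-\beta,\beta]}=\max_{[-\beta,\beta]}|f'|$; $F$ is a function with $F'=-f$; $u_{\rm init}\in\mathcal{M}_h$ is the (grid-projected) initial value; $\kappa>0$ is a stabilizing constant; $\sigma:\mathbb{R}\to\mathbb{R}$ is continuously differentiable with $\sigma>0$ and $\sigma'\ge0$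 on $\mathbb{R}$. Notation. $E_{1h}(v)=\langle F(v),1\rangle$ and $g(v,r)=\sigma(r)/\sigma(E_{1h}(v))$ for $v\in\mathcal{M}_h$, $r\in\mathbb{R}$. GSAV-EI2 scheme with step $\tau>0$. $u^0=u_{\rm init}$, $s^0=E_{1h}(u^0)$; let $\phi_1(a)=a^{-1}(e^a-1)$ for $a\ne0$. For $n\ge0$, given $(u^n,s^n)$: (Prediction) with $L_\kappa^n=\kappa g(u^n,s^n)I-\varepsilon^2\Delta_h$ and $N_\kappa^n(v,r)=g(v,r)f(v)+\kappa g(u^n,s^n)v$, $$\widetilde u^{n+1}=e^{-\tau L_\kappa^n}u^n+\tau\phi_1(-\tau L_\kappa^n)N_\kappa^n(u^n,s^n),\qquad \widetilde s^{n+1}=s^n-g(u^n,s^n)\langle f(u^n),\widetilde u^{n+1}-u^n\rangle,$$ and $\widetilde u^{n+\frac12}=\frac12(u^n+\widetilde u^{n+1})$, $\widetilde s^{n+\frac12}=\frac12(s^n+\widetilde s^{n+1})$. (Correction) with $\widetilde g=g(\widetilde u^{n+\frac12},\widetilde s^{n+\frac12})$, $L_\kappa^{n+\frac12}=\kappa\widetilde g I-\varepsilon^2\Delta_h$ and $N_\kappa^{n+\frac12}(v,r)=g(v,r)f(v)+\kappa\widetilde g v$, $$u^{n+1}=e^{-\tau L_\kappa^{n+\frac12}}u^n+\tau\phi_1(-\tau L_\kappa^{n+\frac12})N_\kappa^{n+\frac12}(\widetilde u^{n+\frac12},\widetilde s^{n+\frac12}),$$ $$s^{n+1}=s^n-\widetilde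 g\,\langle f(\widetilde u^{n+\frac12}),u^{n+1}-u^n\rangle+\frac{\kappa}{2}\widetilde g\,\langle u^{n+1}-\widetilde u^{n+1},u^{n+1}-u^n\rangle.$$ *)

(* Defs.v *)
From HB Require Import structures.
From mathcomp Require Import all_boot all_order all_algebra.
From mathcomp Require Import all_classical all_reals all_analysis.
From mathcomp Require Import ring.

Set Implicit Arguments.
Unset Strict Implicit.
Unset Printing Implicit Defensive.

Import Order.TTheory GRing.Theory Num.Theory.
Import numFieldNormedType.Exports.

Local Open Scope classical_set_scope.
Local Open Scope ring_scope.

Definition C1 (R : realType) (f : R -> R) : Prop :=
  (forall x, derivable f x 1) /\ continuous f^`()%classic.

(* The supremum is a maximum as soon as [f] is C1 and [a <= b]. *)
Definition deriv_supnorm (R : realType) (a b : R) (f : R -> R) : R :=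
  sup [set `|f^`()%classic x| | x in `[a, b]].

(* [phi(A)] for a diagonalizable endomorphism [A] (every self-adjoint operator
   is one): [phi(A)] scales by [phi lambda] each vector of an eigenbasis, where
   [lambda] is its eigenvalue.  By [is_opfunE] it does not depend on the
   eigenbasis.  [opfun] has the junk value 0 when [A] is not diagonalizable. *)
Definition is_opfun (K : fieldType) (V : vectType K) (phi : K -> K)
    (A B : 'End(V)) : Prop :=
  exists e : seq V, basis_of fullv e /\
    forall x, x \in e ->
      exists lambda, A x = lambda *: x /\ B x = phi lambda *: x.

Lemma is_opfunE (K : fieldType) (V : vectType K) (phi : K -> K)
    (A B : 'End(V)) (lambda : K) (v : V) :
  is_opfun phi A B -> A v = lambda *: v -> B v = phi lambda *: v.
Proof.
case=> e [be eE] Av.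
have fe := basis_free be.
pose E := in_tuple e.
pose P (i : 'I_(size e)) l := A E`_i = l *: E`_i /\ B E`_i = phi l *: E`_i.
have /choice[l lP] : forall i, exists l, P i l.
  by move=> i; apply: eE; rewrite mem_nth.
have vE : v = \sum_i coord E i v *: E`_i.
  by apply: coord_span; rewrite (span_basis be) memvf.
have cE i : coord E i v * l i = coord E i v * lambda.
  have : A v = \sum_j (coord E j v * l j) *: E`_j.
    rewrite [in LHS]vE linear_sum; apply: eq_bigr => j _.
    by rewrite linearZ /= (lP j).1 scalerA.
  move/(congr1 (coord E i)); rewrite Av linearZ /= coord_sum_free//.
  by move=> /esym ->; rewrite mulrC.
rewrite [in LHS]vE [in RHS]vE linear_sum scaler_sumr; apply: eq_bigr => i _.
rewrite linearZ /= (lP i).2 !scalerA; congr (_ *: _).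
have [->|ci0] := eqVneq (coord E i v) 0; first by rewrite mul0r mulr0.
by rewrite mulrC (mulfI ci0 (cE i)).
Qed.

Definition opfun (K : fieldType) (V : vectType K) (phi : K -> K)
    (A : 'End(V)) : 'End(V) :=
  xget 0 [set B : 'End(V) | is_opfun phi A B].

(* Only used away from [a = 0], where it has the junk value 0 instead of 1: the
   eigenvalues of [- tau *: Lop c] below are negative when [0 < c]. *)
Definition phi1 (R : realType) (a : R) : R := a^-1 * (expR a - 1).

Section Grid.
Variables (R : realType) (M : nat).

(* An M-periodic grid function on Z x Z is given by its values on one period,
   a matrix [v : 'M[R]_M]; [ordS] and [ord_pred] are the cyclic shifts
   i |-> i +- 1 of ['I_M].  The norm [`|v|] of MathComp-Analysis on matrices is
   max_(i, j) `|v i j| ([mx_normrE]). *)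

Definition gdot (h : R) (v w : 'M[R]_M) : R :=
  h ^+ 2 * \sum_(i < M) \sum_(j < M) v i j * w i j.

Definition lap_fun (h : R) (v : 'M[R]_M) : 'M[R]_M :=
  \matrix_(i, j) (h ^- 2 * (v (ordS i) j + v (ord_pred i) j
                          + v i (ordS j) + v i (ord_pred j) - 4 * v i j)).

Fact lap_fun_is_linear (h : R) : linear (lap_fun h).
Proof. by move=> a v w; apply/matrixP => i j; rewrite !mxE; ring. Qed.

HB.instance Definition _ (h : R) :=
  GRing.isLinear.Build R 'M[R]_M 'M[R]_M _ (lap_fun h) (lap_fun_is_linear h).

Definition lap (h : R) : 'End('M[R]_M) := linfun (lap_fun h).

End Grid.

Section Scheme.
Variables (R : realType) (M : nat).
Variables (h eps kappa : R) (f F sigma : R -> R) (tau : R).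

Local Notation grid := 'M[R]_M.

Definition E1 (v : grid) : R := gdot h (map_mx F v) (const_mx 1).

Definition g (v : grid) (r : R) : R := sigma r / sigma (E1 v).

(* [c] is the value of [g] frozen in the stabilization: g(u^n, s^n) in the
   prediction, and g at the intermediate state in the correction. *)
Definition Lop (c : R) : 'End(grid) :=
  (kappa * c) *: \1%VF - eps ^+ 2 *: lap M h.

Definition Nfun (c : R) (v : grid) (r : R) : grid :=
  g v r *: map_mx f v + (kappa * c) *: v.

Definition exp_step (c : R) (u w : grid) : grid :=
  opfun expR (- tau *: Lop c) u + tau *: opfun (@phi1 R) (- tau *: Lop c) w.

Definition predict (us : grid * R) : grid * R :=
  let: (u, s) := us in
  let c := g u s in
  let ut := exp_step c u (Nfun c u s) in
  let st := s - c * gdot h (map_mx f u) (ut - u) in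
  (ut, st).

Definition gsav_ei2_step (us : grid * R) : grid * R :=
  let: (u, s) := us in
  let: (ut, st) := predict us in
  let uh := 2^-1 *: (u + ut) in
  let sh := 2^-1 * (s + st) in
  let c := g uh sh in
  let u' := exp_step c u (Nfun c uh sh) in
  let s' := s - c * gdot h (map_mx f uh) (u' - u)
              + kappa / 2 * c * gdot h (u' - ut) (u' - u) in
  (u', s').

Definition gsav_ei2 (u_init : grid) (n : nat) : grid * R :=
  iter n gsav_ei2_step (u_init, E1 u_init).

End Scheme.

(* Main.v *)
(* Both stages have the form e^A u + tau phi_1(A) w, with
   A = - tau (a I - eps^2 Delta_h), a = kappa c > 0 and w = c (f(v) + kappa v):
   this is the value at time tau of the solution of
   z' = - a z + eps^2 Delta_h z + w, z(0) = u.  It is the limit of the explicit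
   Euler iterates z + (tau/n) (- a z + eps^2 Delta_h z + w), and for n large each
   Euler step is an entrywise convex combination of values bounded by beta,
   because |w| <= a beta.  The last bound holds because x |-> f(x) + kappa x is
   nondecreasing on [-beta, beta] when kappa >= |f'|, and f(beta) <= 0 <= f(-beta)
   controls it at both ends. *)
Require Import Defs.
From mathcomp Require Import all_boot all_order all_algebra.
From mathcomp Require Import all_classical all_reals all_analysis.
From mathcomp Require Import ring lra.

Set Implicit Arguments.
Unset Strict Implicit.
Unset Printing Implicit Defensive.

Import Order.TTheory GRing.Theory Num.Theory.
Import numFieldNormedType.Exports.

Local Open Scope classical_set_scope.
Local Open Scope ring_scope.

(** * Functions of a diagonalizable operator *)

(** The eigenbasis that serves [phi] serves [psi]: prescribe [C] on it and extend linearly. One case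
    distinction on diagonalizability thus settles [expR] and [phi1] together. *)
Lemma is_opfun_exists (K : fieldType) (V : vectType K) (phi psi : K -> K)
    (A B : 'End(V)) :
  is_opfun phi A B -> exists C, is_opfun psi A C.
Proof.
case=> e [be eE].
have /choice[l lP] : forall x, exists l, x \in e -> A x = l *: x.
  move=> x; have [/eE[l [Ax _]]|xNe] := boolP (x \in e); first by exists l.
  by exists 0.
pose fX := [seq psi (l x) *: x | x <- e].
have [C CP] := linear_of_free e fX.
exists (linfun C), e; split=> // x xe; exists (l x); split; first exact: lP.
rewrite lfunE /=.
move: (CP (basis_free be) (size_map _ _)) => /eq_in_map/(_ x xe) ->//.
Qed.

(** * Euler's limit for the scalar exponential *)

Lemma bernoulli_exprB (R : realDomainType) (n : nat) (y : R) :
  0 <= y -> y <= 1 -> 1 - n%:R * y <= (1 - y) ^+ n.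
Proof.
move=> y0 y1; elim: n => [|n IH]; first by rewrite mul0r subr0.
rewrite exprS -natr1; apply: le_trans (ler_wpM2l _ IH); last by lra.
rewrite -subr_ge0.
have -> : (1 - y) * (1 - n%:R * y) - (1 - (n%:R + 1) * y) = n%:R * y ^+ 2.
  by ring.
by rewrite mulr_ge0// sqr_ge0.
Qed.

Lemma cvg_inv_succM (R : realType) (c : R) :
  n.+1%:R^-1 * c @[n --> \oo] --> (0 : R).
Proof. by rewrite -(mul0r c); apply: cvgMr_tmp; exact: cvg_harmonic. Qed.

(** Squeeze: elementary bounds on 1 + x/(n+1) are raised to the power n+1, and Bernoulli's
    inequality shows that the lower one loses only the factor 1 - x^2/(n+1). *)
Lemma cvg_euler_expR (R : realType) (x : R) :
  (1 + n.+1%:R^-1 * x) ^+ n.+1 @[n --> \oo] --> expR x.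
Proof.
have ub n : n.+1%:R^-1 * `|x| <= 1 -> expR x * (1 - n.+1%:R^-1 * x ^+ 2)
    <= (1 + n.+1%:R^-1 * x) ^+ n.+1 <= expR x.
  set d := n.+1%:R^-1 => dx.
  have n0 : n.+1%:R != 0 :> R by rewrite pnatr_eq0.
  have d0 : 0 < d by rewrite invr_gt0.
  have {}dx : `|d * x| <= 1 by rewrite normrM gtr0_norm.
  move: (dx); rewrite ler_norml => /andP[dx1 dx2].
  have expx : expR x = expR (d * x) ^+ n.+1.
    by rewrite -expRM_natl mulrA mulfV ?mul1r.
  (* [e^y (1 - y^2) <= 1 + y <= e^y] for [`|y| <= 1], applied to [y = d * x]. *)
  have lb : expR (d * x) * (1 - (d * x) ^+ 2) <= 1 + d * x.
    have -> : 1 - (d * x) ^+ 2 = (1 - d * x) * (1 + d * x) by ring.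
    rewrite mulrA -[leRHS]mul1r ler_wpM2r//; first by lra.
    apply: (@le_trans _ _ (expR (d * x) * expR (- (d * x)))).
      by rewrite ler_wpM2l ?expR_ge0//; exact: expR_ge1Dx.
    by rewrite expRxMexpNx_1.
  apply/andP; split; last first.
    rewrite expx; apply: lerXn2r; rewrite ?nnegrE ?expR_ge0//; first lra.
    exact: expR_ge1Dx.
  have sq1 : (d * x) ^+ 2 <= 1 by rewrite -real_normK ?num_real// exprn_ile1.
  have sq0 : 0 <= (d * x) ^+ 2 by exact: sqr_ge0.
  rewrite expx.
  apply: (@le_trans _ _ ((expR (d * x) * (1 - (d * x) ^+ 2)) ^+ n.+1)).
    rewrite exprMn ler_wpM2l ?exprn_ge0 ?expR_ge0//.
    apply: le_trans (bernoulli_exprB n.+1 sq0 sq1).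
    by rewrite [(d * x) ^+ 2]exprMn [d ^+ 2]expr2 !mulrA mulfV// mul1r.
  apply: lerXn2r; rewrite ?nnegrE//; last lra.
  by rewrite mulr_ge0 ?expR_ge0//; lra.
apply: (@squeeze_cvgr _ _ _ _ (fun n => expR x * (1 - n.+1%:R^-1 * x ^+ 2))
          (fun=> expR x)); last exact: cvg_cst.
- near=> n; apply: ub.
  near: n; exact: (cvgr_le _ (cvg_inv_succM _)).
- rewrite -[in X in _ --> X](mulr1 (expR x)) -[in X in _ --> X](subr0 1).
  apply: cvgM; first exact: cvg_cst.
  by apply: cvgB; [exact: cvg_cst | exact: cvg_inv_succM].
Unshelve. all: by end_near. Qed.

(** * Euler iterates in an eigenbasis *)

Section Eigenbasis.
Variables (K : fieldType) (V : vectType K) (A : 'End(V)).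

Lemma is_opfun_eigenbasis (phi : K -> K) (B : 'End(V)) :
  is_opfun phi A B ->
  exists n (E : 'I_n -> V) (l : 'I_n -> K),
    [/\ forall i, A (E i) = l i *: E i, forall i, E i != 0
      & forall v, exists a : 'I_n -> K, v = \sum_i a i *: E i].
Proof.
case=> e [be eE].
have /choice[l lP] : forall i : 'I_(size e), exists l, A e`_i = l *: e`_i.
  by move=> i; have [l [? _]] := eE _ (mem_nth 0 (ltn_ord i)); exists l.
exists (size e), (fun i => e`_i), l; split=> // [i|v].
  exact: free_not0 (basis_free be) (mem_nth 0 (ltn_ord i)).
exists (fun i => coord (in_tuple e) i v).
by apply: (@coord_span _ _ _ (in_tuple e)); rewrite (span_basis be) memvf.
Qed.

Variables (n : nat) (E : 'I_n -> V) (l : 'I_n -> K).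
Hypothesis eigen : forall i, A (E i) = l i *: E i.

Lemma opfun_eigenbasisE (phi : K -> K) (B : 'End(V)) (a : 'I_n -> K) :
  is_opfun phi A B ->
  B (\sum_i a i *: E i) = \sum_i (a i * phi (l i)) *: E i.
Proof.
move=> AB; rewrite linear_sum; apply: eq_bigr => i _.
by rewrite linearZ /= (is_opfunE AB (eigen i)) scalerA.
Qed.

(** Each coordinate follows the scalar affine recursion z -> (1 + d l) z + d b. Its geometric sum
    ((1 + d l)^k - 1) / l is the discrete counterpart of [phi1]. *)
Lemma euler_iter_eigenbasisE (a b : 'I_n -> K) (d : K) (k : nat) :
  (forall i, l i != 0) ->
  iter k (fun v => v + d *: (A v + \sum_i b i *: E i)) (\sum_i a i *: E i) =
  \sum_i (a i * (1 + d * l i) ^+ k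
          + b i * ((l i)^-1 * ((1 + d * l i) ^+ k - 1))) *: E i.
Proof.
move=> l0; elim: k => [|k IH].
  apply: eq_bigr => i _; congr (_ *: _).
  by rewrite !expr0 subrr !mulr0 addr0 mulr1.
rewrite iterS IH linear_sum -big_split scaler_sumr -big_split /=.
apply: eq_bigr => i _.
rewrite linearZ /= eigen !scalerA -scalerDl scalerA -scalerDl; congr (_ *: _).
by rewrite !exprS; move: (_ ^+ k) (l0 i) => X li0; field.
Qed.

End Eigenbasis.

Lemma cvg_sum_scale (R : realType) (V : normedModType R) (T : Type)
    (F : set_system T) (n : nat) (c : 'I_n -> T -> R) (l : 'I_n -> R)
    (E : 'I_n -> V) :
  Filter F -> (forall i, c i x @[x --> F] --> l i) ->
  \sum_i c i x *: E i @[x --> F] --> \sum_i l i *: E i.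
Proof.
move=> FF cl; apply: cvg_big => [|i _]; last exact: cvgZr_tmp.
exact: add_continuous.
Qed.

(** Convergence is checked coordinatewise, with n+1 steps of size 1/(n+1) up to time 1. Injectivity
    of [A] excludes the eigenvalue 0, where [phi1] has its junk value. *)
Lemma cvg_euler_step (R : realType) (M : nat) (A B C : 'End('M[R]_M))
    (u w : 'M[R]_M) :
  is_opfun expR A B -> is_opfun (@phi1 R) A C ->
  (forall x, A x = 0 -> x = 0) ->
  iter n.+1 (fun v => v + n.+1%:R^-1 *: (A v + w)) u @[n --> \oo]
    --> B u + C w.
Proof.
move=> AB AC inj.
have [m [E [l [eigen E0 span]]]] := is_opfun_eigenbasis AB.
have l0 i : l i != 0.
  by apply: contra_neq (E0 i) => li; apply: inj; rewrite eigen li scale0r.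
have [[a ->] [b ->]] := (span u, span w).
rewrite (opfun_eigenbasisE eigen _ AB) (opfun_eigenbasisE eigen _ AC).
have cl i : a i * (1 + n.+1%:R^-1 * l i) ^+ n.+1
    + b i * ((l i)^-1 * ((1 + n.+1%:R^-1 * l i) ^+ n.+1 - 1)) @[n --> \oo]
    --> a i * expR (l i) + b i * phi1 (l i).
  apply: cvgD; apply: cvgMl_tmp; first exact: cvg_euler_expR.
  by apply: cvgMl_tmp; apply: cvgB; [exact: cvg_euler_expR | exact: cvg_cst].
rewrite -big_split (eq_bigr _ (fun i _ => esym (scalerDl _ _ _))).
rewrite (eq_cvg _ _ (fun n => euler_iter_eigenbasisE eigen a b _ n.+1 l0)).
exact: (@cvg_sum_scale R 'M[R]_M _ _ _ _ _ E _ cl).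
Qed.

(** * Maximum-norm bound for one exponential step *)

Lemma mx_normr_le (R : realType) (m n : nat) (v : 'M[R]_(m, n)) (b : R) :
  0 <= b -> (forall i j, `|v i j| <= b) -> `|v| <= b.
Proof.
move=> b0 vb; rewrite [`|v|]mx_normrE.
by apply/bigmax_leP; split=> // i _; exact: vb.
Qed.

Lemma ler_mx_normr (R : realType) (m n : nat) (v : 'M[R]_(m, n)) i j :
  `|v i j| <= `|v|.
Proof.
rewrite [`|v|]mx_normrE.
exact: (le_bigmax 0 (fun ij => `|v ij.1 ij.2|) (i, j)).
Qed.

(** With k = eps^2/h^2, the step restriction makes the centre weight 1 - d a - 4 d k nonnegative.
    Together with the four neighbour weights d k it sums to 1 - d a. *)
Lemma lap_euler_contraction (R : realType) (M : nat) (h eps a d : R)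
    (v : 'M[R]_M) :
  0 <= d -> d * (a + 4 * (eps ^+ 2 * h ^- 2)) <= 1 ->
  `|v - d *: (a *: v - eps ^+ 2 *: lap M h v)| <= (1 - d * a) * `|v|.
Proof.
move=> d0 dle; pose k := eps ^+ 2 * h ^- 2.
have k0 : 0 <= k by rewrite mulr_ge0 ?invr_ge0 ?sqr_ge0.
have dk0 : 0 <= d * k by rewrite mulr_ge0.
have c0 : 0 <= 1 - d * a - 4 * (d * k) by rewrite /k; lra.
apply: mx_normr_le => [|i j]; first by rewrite mulr_ge0//; lra.
rewrite /lap lfunE /= !mxE.
set p := v (ordS i) j; set q := v (ord_pred i) j.
set r := v i (ordS j); set s := v i (ord_pred j).
have -> : v i j - d * (a * v i j -
    eps ^+ 2 * (h ^- 2 * (p + q + r + s - 4 * v i j)))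
  = (1 - d * a - 4 * (d * k)) * v i j + d * k * (p + q + r + s).
  by rewrite /k; ring.
have -> : (1 - d * a) * `|v| = (1 - d * a - 4 * (d * k)) * `|v|
    + d * k * (`|v| + `|v| + `|v| + `|v|) by ring.
apply: (le_trans (ler_normD _ _)); apply: lerD.
  by rewrite normrM (ger0_norm c0) ler_wpM2l ?ler_mx_normr.
rewrite normrM (ger0_norm dk0) ler_wpM2l//.
by do 3 (apply: (le_trans (ler_normD _ _));
  apply: lerD; last exact: ler_mx_normr); exact: ler_mx_normr.
Qed.

Lemma exp_step_mbp (R : realType) (M : nat) (h eps kappa tau c b : R)
    (u w : 'M[R]_M) :
  0 < kappa * c -> 0 < tau -> `|u| <= b -> `|w| <= kappa * c * b ->
  `|exp_step h eps kappa tau c u w| <= b.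
Proof.
move=> a0 t0 ub wb; have b0 := le_trans (normr_ge0 u) ub.
(* [linearZ] moves [tau] into the argument of [phi1(A)], so the source of the Euler scheme is
   [tau *: w]. *)
rewrite /exp_step; set A : 'End('M[R]_M) := - tau *: _; rewrite -linearZ /=.
(* If [A] were not diagonalizable, [opfun] would be 0 and so would be the step;
   the symmetry of the discrete Laplacian is thus not needed. *)
have [[B eB]|nB] := pselect (exists B, is_opfun expR A B); last first.
  have opfun0 phi : opfun phi A = 0.
    apply: xgetPN => B eB; apply: nB; exact: is_opfun_exists eB.
  by rewrite !opfun0 !lfunE /= addr0 normr0.
have eigen phi : is_opfun phi A (opfun phi A).
  by apply: xgetPex; exact: is_opfun_exists eB.
have AE v : A v = - tau *: (kappa * c *: v - eps ^+ 2 *: lap M h v).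
  by rewrite /A /Lop scale_lfunE add_lfunE opp_lfunE !scale_lfunE id_lfunE.
set K := kappa * c + 4 * (eps ^+ 2 * h ^- 2).
have k0 : 0 <= 4 * (eps ^+ 2 * h ^- 2).
  by rewrite mulr_ge0// mulr_ge0 ?invr_ge0 ?sqr_ge0.
have ta0 : 0 < tau * (kappa * c) by rewrite mulr_gt0.
have K0 : 0 < K by rewrite /K; lra.
have stepA (d : R) v : 0 <= d -> d * (tau * K) <= 1 ->
    `|v + d *: A v| <= (1 - d * (tau * (kappa * c))) * `|v|.
  move=> d0 dK; rewrite AE scalerA mulrN scaleNr.
  rewrite (mulrA d tau (kappa * c)); apply: lap_euler_contraction.
    by rewrite mulr_ge0// ltW.
  by rewrite -mulrA.
(* At the largest admissible step d = 1/(tau K), a kernel vector is fixed by a map that contracts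
   its norm by a factor less than 1. *)
have inj v : A v = 0 -> v = 0.
  move=> Av; pose d := (tau * K)^-1.
  have d0 : 0 < d by rewrite invr_gt0 mulr_gt0.
  have := @stepA d v (ltW d0); rewrite Av scaler0 addr0 mulVf ?gt_eqF ?mulr_gt0//.
  move=> /(_ (lexx _)); rewrite mulrBl mul1r lerBrDr gerDl.
  by rewrite pmulr_rle0 ?(mulr_gt0 d0 ta0)// => v0; apply/eqP; rewrite -normr_le0.
have cv := @cvg_euler_step _ _ _ _ _ u (tau *: w)
  (eigen expR) (eigen (@phi1 R)) inj.
(* The bound is closed under limits, so it suffices to prove it for the Euler iterates once 1/(n+1)
   meets the step restriction. *)
apply: (closed_cvg (fun x : R => x <= b) (@closed_le _ b) _ _ (cvg_norm cv)).
near=> n.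
have : n.+1%:R^-1 * (tau * K) <= 1 by near: n; exact: (cvgr_le _ (cvg_inv_succM _)).
set d := n.+1%:R^-1 => dK.
have d0 : 0 <= d by rewrite invr_ge0.
suff H k : `|iter k (fun v => v + d *: (A v + tau *: w)) u| <= b by exact: H.
elim: k => [//|k IH]; rewrite iterS; set v := iter k _ _ in IH *.
rewrite scalerDr addrA; apply: (le_trans (ler_normD _ _)).
have dt0 : 0 <= d * tau by rewrite mulr_ge0// ltW.
rewrite scalerA normrZ (ger0_norm dt0).
(* What the contraction takes from [b] is exactly what the source may add. *)
have -> : b = (1 - d * (tau * (kappa * c))) * b + d * tau * (kappa * c * b).
  by ring.
apply: lerD; last by rewrite ler_wpM2l.
apply: (le_trans (stepA _ _ d0 dK)); rewrite ler_wpM2l// subr_ge0.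
apply: le_trans dK; rewrite ler_wpM2l// ler_wpM2l ?(ltW t0)//.
by rewrite /K lerDl.
Unshelve. all: by end_near. Qed.

(** * Bound on the stabilized nonlinearity *)

Lemma stabilized_bound (R : realType) (f : R -> R) (b kappa x : R) :
  C1 f -> 0 < b -> f b <= 0 -> 0 <= f (- b) ->
  deriv_supnorm (- b) b f <= kappa ->
  `|x| <= b -> `|f x + kappa * x| <= kappa * b.
Proof.
move=> [df cf] b0 fb fNb fk; rewrite ler_norml => /andP[xl xr].
have bb : - b <= b by lra.
have f'k y : - b <= y <= b -> `|f^`()%classic y| <= kappa.
  move=> yb; apply: le_trans fk.
  (* Continuity of f' bounds the set under [sup], which makes [deriv_supnorm] a genuine upper
     bound. *)
  have [] := @EVT_max R (fun y => `|f^`()%classic y|) _ _ bb.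
    apply: continuous_subspaceT => z; apply: continuous_comp; first exact: cf.
    exact: norm_continuous.
  move=> z _ zmax; apply: ub_le_sup.
    by exists `|f^`()%classic z| => _ [t tb <-]; exact: zmax.
  by exists y => //=; rewrite in_itv.
pose G y := f y + kappa * y.
have dG (y : R) : is_derive y 1 G (f^`()%classic y + kappa).
  rewrite derive1E; have dfy := derivableP (df y).
  have dk : is_derive y 1 ( *%R kappa) kappa.
    by apply: is_derive_eq; exact: mulr1.
  exact: is_deriveD.
have ndG : {in `[- b, b] &, {homo G : y z / y <= z}}.
  apply: ger0_derive1_le_cc => [y _|y|].
  - exact: ex_derive.
  - rewrite in_itv /= => /andP[y1 y2]; rewrite derive1E derive_val.
    have := f'k y; rewrite (ltW y1) (ltW y2) => /(_ isT).
    rewrite ler_norml => /andP[? _]; lra.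
  - apply: continuous_subspaceT => y; apply: differentiable_continuous.
    by apply/derivable1_diffP; exact: ex_derive.
(* G(-b) <= G(x) <= G(b), where the sign conditions give G(b) <= kappa b and G(-b) >= - kappa b. *)
have := ndG _ _ _ _ xl; have := ndG _ _ _ _ xr.
rewrite !in_itv /= !lexx xl xr bb /G => /(_ isT isT) h1 /(_ isT isT) h2.
by rewrite ler_norml; apply/andP; split; nra.
Qed.

Lemma Nfun_bound (R : realType) (M : nat) (h kappa : R) (f F sigma : R -> R)
    (b r : R) (v : 'M[R]_M) :
  (forall x, `|x| <= b -> `|f x + kappa * x| <= kappa * b) ->
  0 <= kappa -> 0 <= g h F sigma v r -> `|v| <= b ->
  `|Nfun h kappa f F sigma (g h F sigma v r) v r|
    <= kappa * g h F sigma v r * b.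
Proof.
move=> fb k0 c0 vb; rewrite /Nfun; move: (g _ _ _ _ _) c0 => c c0.
have b0 := le_trans (normr_ge0 v) vb.
apply: mx_normr_le => [|i j]; first by rewrite mulr_ge0// mulr_ge0.
rewrite !mxE [kappa * c]mulrC -!mulrA -mulrDr normrM (ger0_norm c0).
apply: ler_wpM2l => //; exact/fb/(le_trans (ler_mx_normr _ _ _)).
Qed.

Theorem theorem3p10 (R : realType) (L : R) (hL : 0 < L)
    (M : nat) (hM : (0 < M)%N)
    (eps : R) (heps : 0 < eps)
    (f : R -> R) (hf : C1 f)
    (beta : R) (hbeta : 0 < beta) (hfbeta : f beta <= 0 /\ 0 <= f (- beta))
    (F : R -> R) (hF : forall x : R, is_derive x 1 F (- f x))
    (kappa : R) (hkappa : 0 < kappa)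
    (sigma : R -> R) (hsigma : C1 sigma)
    (hsigma_pos : forall r : R, 0 < sigma r)
    (hsigma_mono : forall r : R, 0 <= sigma^`()%classic r)
    (u_init : 'M[R]_M) :
  deriv_supnorm (- beta) beta f <= kappa ->
  forall tau : R, 0 < tau ->
  `|u_init| <= beta ->
  forall n : nat,
    `|(gsav_ei2 (L / M%:R) eps kappa f F sigma tau u_init n).1| <= beta.
Proof.
move=> fk tau t0 ub n; have [fb fNb] := hfbeta.
have Nb x : `|x| <= beta -> `|f x + kappa * x| <= kappa * beta.
  exact: stabilized_bound.
have g0 v r : 0 < g (L / M%:R) F sigma v r by rewrite /g divr_gt0.
(* Covers both stages: v = u for the prediction, v the midpoint for the correction. The scalar r
   enters only through g > 0, whatever its value. *)
have stage u v r : `|u| <= beta -> `|v| <= beta ->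
    `|exp_step (L / M%:R) eps kappa tau (g (L / M%:R) F sigma v r) u
        (Nfun (L / M%:R) kappa f F sigma (g (L / M%:R) F sigma v r) v r)|
      <= beta.
  move=> u1 v1; apply: exp_step_mbp => //; first by rewrite mulr_gt0.
  by apply: Nfun_bound => //; exact: ltW.
elim: n => [//|n]; rewrite /gsav_ei2 iterS; case: (iter n _ _) => u s /= IH.
(* The midpoint of u and the predicted value is bounded by beta, since [stage] bounds the
   prediction. *)
apply: (stage) => //; rewrite normrZ ger0_norm// ler_pdivrMl//.
apply: (le_trans (ler_normD _ _)); by rewrite mulr_natl mulr2n lerD// stage.
Qed.
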